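(* Let $0\leq a<b$ be real numbers and let $\gamma=a/b$. Then for all integers $k\geq 2$, $$E_k(x\log(x),[a,b])\leq b\,(1-\sqrt{\gamma})\,\frac{1+\gamma+2k\sqrt{\gamma}}{4(k^2-1)}\left(\frac{1-\sqrt{\gamma}}{1+\sqrt{\gamma}}\right)^{k}.$$
   Context: $\log$ is the natural logarithm, with the convention $0\cdot\log(0)=0$, so $x\log(x)$ is continuous on $[0,\infty)$. For an integer $k\ge 0$, $\Pi_k$ denotes the set of all polynomials of degree at most $k$ (real coefficients), and for a continuous function $f:[a,b]\to\mathbb{R}$, $$E_k(f,[a,b])=\min_{p\in\Pi_k}\max_{x\in[a,b]}|f(x)-p(x)|$$ is the error of the best uniform polynomial approximation of degree at most $k$. *)

(* Defs.v *)
From mathcomp Require Import all_boot all_order all_algebra.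
From mathcomp Require Import all_classical all_reals all_analysis.
Set Implicit Arguments.
Unset Strict Implicit.
Unset Printing Implicit Defensive.
Import Order.TTheory GRing.Theory Num.Theory.
Local Open Scope classical_set_scope.
Local Open Scope ring_scope.

Definition uniform_error (R : realType) (f : R -> R) (a b : R) (p : {poly R})
    : R :=
  sup [set `|f x - p.[x]| | x in `[a, b]].

(* For a <= b and f continuous on [a, b], the supremum above is a maximum
   (extreme value theorem) and the infimum below is a minimum (existence of
   best approximations from a finite-dimensional space). Both are then taken
   over nonempty sets of nonnegative reals, the first one bounded above, so
   the default values of sup and inf play no role.
   [size p <= k.+1] says that p has degree at most k, p = 0 included. *)
Definition best_approx_error (R : realType) (k : nat) (f : R -> R) (a b : R)
    : R :=
  inf [set uniform_error f a b p | p in [set p : {poly R} | (size p <= k.+1)%N]].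

(* Main.v *)
Require Import Defs.
From mathcomp Require Import all_boot all_order all_algebra.
From mathcomp Require Import all_classical all_reals all_analysis.
From mathcomp Require Import ring lra.
Import Order.TTheory GRing.Theory Num.Theory.
Import numFieldNormedType.Exports.
Local Open Scope classical_set_scope.
Local Open Scope ring_scope.

(** The bound comes from integrating, over a parameter, the explicit best
    approximation of a simple pole.

    With s = sqrt (a / b), r = (1 - s) / (1 + s) and m = b / (1 + r)^2, the
    interval is [m (1 - r)^2, m (1 + r)^2], so each of its points has the form
    y = m |1 + r e^(it)|^2 = m (1 + r^2 + 2 r cos t), and a polynomial of
    degree at most k in y is one in cos t.  Write X_x = 1 + x^2 + 2 x cos t.
    Since y ln y = m X_r ln X_r + (ln m) y, only X_r ln X_r has to be
    approximated.

    Let x run from 0 to r and follow E(x) = X_r ln X_x + Q(x), where Q(x) is a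
    polynomial in cos t of degree at most k that vanishes at x = 0.  The error
    sought is E(r), and E(0) = 0.  Put w(x) = (r - x) (1 - r x); then
    w(x) = r X_x - x X_r, so that
      X_r (ln X_x)' = 2 r (x + cos t) / x - (w(x) / x) (ln X_x)',
    where (ln X_x)' has the cosine expansion
      2 (cos t - x cos (2t) + x^2 cos (3t) - x^3 cos (4t) + ...).
    If Q cancels the contribution of the first k terms, there remains the tail
      2 (-x)^k Re (e^(i(k+1)t) / (1 + x e^(it)))
    multiplied by - w(x) / x ([kernel_sum]).  Keeping only this tail would give
    a bound too large by a factor that, for a = 0, tends to 2 as k grows.
    Adding x / (1 - x^2) cos (kt) to the real part turns it into
      Re (e^(ikt) (e^(it) + x) / (1 + x e^(it))) / (1 - x^2),
    a Blaschke factor divided by 1 - x^2, hence at most 1 / (1 - x^2) in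
    absolute value ([blaschke_le1]): this is Bernstein's extremal error for the
    approximation of a simple pole.  The corresponding term of Q is provided by
    [antiderivative_singular_weight].

    Altogether |E'(x)| <= 2 w(x) x^(k-1) / (1 - x^2), and by [weight_le] this
    is at most r^2 / (1 + r) (x^(k-2) - x^k).  Integrating over [0, r]
    ([dominated_increment]) gives
      r^(k+1) / (1 + r) (1 / (k-1) - r^2 / (k+1)),
    which, times m, is exactly the announced bound.  The argument reaches
    r = 1, that is a = 0, because w(x) / (1 - x^2) stays bounded there. *)

(** * Differentiation rules and comparison of increments *)

Lemma is_derive_add {R : realType} {f g : R -> R} {x df dg : R} :
  is_derive x 1 f df -> is_derive x 1 g dg ->
  is_derive x 1 (fun y => f y + g y) (df + dg).
Proof. by move=> hf hg; exact: (is_deriveD hf hg). Qed.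

Lemma is_derive_scale {R : realType} {f : R -> R} (c : R) {x df : R} :
  is_derive x 1 f df -> is_derive x 1 (fun y => c * f y) (c * df).
Proof. by move=> hf; exact: (is_deriveZ c hf). Qed.

Lemma is_derive_monomial {R : realType} (n : nat) (x : R) :
  is_derive x 1 (fun y : R => y ^+ n.+1 / n.+1%:R) (x ^+ n).
Proof.
have h := is_deriveX n.+1 (is_derive_id x (1 : R)).
have h2 := is_derive_scale n.+1%:R^-1 h.
have -> : (fun y : R => y ^+ n.+1 / n.+1%:R)
  = (fun y => n.+1%:R^-1 * (id ^+ n.+1 : R -> R) y).
  by apply/funext => y; rewrite mulrC fctE.
apply: (is_derive_eq h2); rewrite /GRing.scale /= mulr1 mulrA mulVf ?mul1r//.
Qed.

Lemma is_derive_bigsum {R : realType} n (F : nat -> R -> R)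
    (G : nat -> R) (x : R) :
  (forall i, is_derive x 1 (F i) (G i)) ->
  is_derive x 1 (fun y => \sum_(i < n) F i y) (\sum_(i < n) G i).
Proof.
move=> h; rewrite (_ : (fun _ => _) = \sum_(i < n) F i); last first.
  by apply/funext => y; rewrite fct_sumE.
by apply: is_derive_sum.
Qed.

(** The mean value theorem applied to g - s f for s = 1 and s = -1: it lets a
    pointwise bound on a derivative be integrated without any integral. *)
Lemma dominated_increment {R : realType} (f g df dg : R -> R) {a : R} :
  0 < a ->
  (forall x, 0 <= x <= a -> is_derive x 1 f (df x)) ->
  (forall x, 0 <= x <= a -> is_derive x 1 g (dg x)) ->
  (forall x, 0 < x < a -> `|df x| <= dg x) ->
  `|f a - f 0| <= g a - g 0.
Proof.
move=> a0 hf hg hle.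
suff main (s : R) : `|s| <= 1 -> s * (f a - f 0) <= g a - g 0.
  have h1 := main 1; have h2 := main (-1).
  rewrite ler_norml; move: h1 h2; rewrite normrN normr1 lexx.
  by move=> /(_ isT) h1 /(_ isT) h2; apply/andP; split; lra.
move=> s1.
pose h (y : R) := g y + (- s) * f y.
have hd x : 0 <= x <= a -> is_derive x 1 h (dg x + (- s) * df x).
  by move=> xa; apply: is_derive_add; [exact: hg|exact/is_derive_scale/hf].
have hc : {within `[0, a], continuous h}.
  apply: derivable_within_continuous => x; rewrite in_itv/= => /hd hx.
  exact: ex_derive.
have hoo x : x \in `]0, a[%R -> is_derive x 1 h (dg x + (- s) * df x).
  by rewrite in_itv/= => /andP[x0 xa]; apply: hd; rewrite !ltW.
have [c] := @MVT R h (fun x => dg x + (- s) * df x) 0 a a0 hoo hc.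
rewrite in_itv/= => cI hE.
have : 0 <= h a - h 0.
  rewrite hE subr0; apply: mulr_ge0; last exact: ltW.
  have := hle c cI; have : s * df c <= `|df c|.
    apply: (le_trans (ler_norm _)); rewrite normrM.
    by rewrite -[leRHS]mul1r ler_wpM2r.
  lra.
rewrite /h; lra.
Qed.

(** * Polynomials in the cosine *)

Lemma cos_mulrSS {R : realType} (t : R) n :
  cos (t *+ n.+2) = 2 * cos t * cos (t *+ n.+1) - cos (t *+ n).
Proof.
rewrite (_ : t *+ n.+2 = t *+ n.+1 + t); last by rewrite [LHS]mulrSr.
rewrite (_ : t *+ n = t *+ n.+1 - t); last by rewrite mulrSr; ring.
rewrite cosD cosB; ring.
Qed.

(** Membership in the image of the polynomials of degree at most [k] under
    the substitution of [cos t]; unlike a chosen polynomial, this predicate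
    lets the approximant be assembled term by term as a function of [t]. *)
Definition cos_poly {R : realType} (k : nat) (f : R -> R) :=
  exists2 p : {poly R}, (size p <= k.+1)%N & forall t, f t = p.[cos t].

Lemma cos_polyD {R : realType} k (f g : R -> R) :
  cos_poly k f -> cos_poly k g -> cos_poly k (fun t => f t + g t).
Proof.
move=> [p sp fp] [q sq gq]; exists (p + q) => [|t].
  by rewrite (leq_trans (size_polyD _ _))// geq_max sp.
by rewrite hornerD fp gq.
Qed.

Lemma cos_polyZ {R : realType} k c (f : R -> R) :
  cos_poly k f -> cos_poly k (fun t => c * f t).
Proof.
move=> [p sp fp]; exists (c *: p) => [|t].
  by rewrite (leq_trans (size_scale_leq _ _)).
by rewrite hornerZ fp.
Qed.

Lemma cos_poly_sum {R : realType} k n (F : nat -> R -> R) :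
  (forall i, (i < n)%N -> cos_poly k (F i)) ->
  cos_poly k (fun t => \sum_(i < n) F i t).
Proof.
elim: n => [|n IHn] hF.
  by exists 0 => [|t]; rewrite ?size_poly0// horner0 big_ord0.
have [p sp hp] : cos_poly k (fun t => \sum_(i < n) F i t + F n t).
  by apply: cos_polyD; [apply: IHn => i /ltnW/hF | exact: hF].
by exists p => // t; rewrite big_ord_recr /= hp.
Qed.

Lemma cos_poly_widen {R : realType} n k (f : R -> R) :
  (n <= k)%N -> cos_poly n f -> cos_poly k f.
Proof. by move=> nk [p sp fp]; exists p => //; exact: leq_trans sp _. Qed.

(** The Chebyshev polynomials, obtained from their three-term recurrence. *)
Lemma cos_poly_multiple {R : realType} k n :
  (n <= k)%N -> cos_poly k (fun t : R => cos (t *+ n)).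
Proof.
move=> /cos_poly_widen; apply.
suff [] : cos_poly n (fun t : R => cos (t *+ n)) /\
  cos_poly n.+1 (fun t : R => cos (t *+ n.+1)) by [].
elim: n => [|n [hn hn1]]; split=> //.
- by exists 1 => [|t]; rewrite ?size_poly1// mulr0n cos0 hornerE.
- by exists 'X => [|t]; rewrite ?size_polyX// mulr1n hornerX.
have [p sp hp] := hn; have [q sq hq] := hn1.
exists (2 *: ('X * q) - p) => [|t].
  rewrite (leq_trans (size_polyD _ _))// geq_max size_polyN.
  rewrite (leq_trans sp) ?andbT; last by rewrite !ltnS -addn2 leq_addr.
  rewrite (leq_trans (size_scale_leq _ _))//.
  by rewrite (leq_trans (size_polyMleq _ _))// size_polyX.
by rewrite cos_mulrSS hp hq hornerD hornerN hornerZ hornerM hornerX mulrA.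
Qed.

(** * The weight and its antiderivatives *)

(** Only existence matters, as the function ends up in a coefficient of the
    approximant; it comes from x^(k+1) / (1 + x) = x^k - x^k / (1 + x). *)
Lemma antiderivative_geometric (R : realType) (k : nat) :
  exists2 F : R -> R, F 0 = 0 &
  forall x : R, -1 < x -> is_derive x 1 F (x ^+ k / (1 + x)).
Proof.
elim: k => [|k [F F0 dF]].
  exists (fun x => ln (1 + x)) => [|x x1]; first by rewrite addr0 ln1.
  have x0 : 0 < 1 + x by lra.
  have h : is_derive x 1 (fun y : R => 1 + y) (0 + 1).
    exact: (is_derive_add (f := cst 1)
      (is_derive_cst _ _ _) (is_derive_id _ _)).
  have := @is_derive1_comp R (@ln R) (fun y : R => 1 + y) x _ _
    (is_derive1_ln x0) h.
  by move=> h2; apply: (is_derive_eq h2); rewrite expr0 add0r mulr1 mul1r.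
exists (fun x => x ^+ k.+1 / k.+1%:R + (-1) * F x) => [|x x1].
  by rewrite F0 expr0n /= mul0r mulr0 addr0.
have h := is_derive_add (is_derive_monomial k x)
  (is_derive_scale (-1) (dF x x1)).
apply: (is_derive_eq h); rewrite exprS; field; lra.
Qed.

(** It equals r X_x - x X_r, whatever the angle t. *)
Definition weight {R : realType} (r x : R) : R := (r - x) * (1 - r * x).

(** The partial fractions
      w(x) / (1 - x^2) = - r + (1 + r)^2 / (2 (1 + x)) - (1 - r)^2 / (2 (1 - x))
    reduce this to [antiderivative_geometric] at x and at - x.  The pole at
    x = 1 is reached only when r = 1, and then its coefficient vanishes, so
    that the formula is valid up to the closed end point x = r. *)
Lemma antiderivative_singular_weight {R : realType} (r : R) (k : nat) :
  0 < r <= 1 ->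
  exists2 B : R -> R, B 0 = 0 & forall x : R, 0 <= x <= r ->
    is_derive x 1 B (weight r x * x ^+ k / (1 - x ^+ 2)).
Proof.
move=> /andP[r0 r1]; have [F F0 dF] := antiderivative_geometric R k.
exists (fun x => (- r) * (x ^+ k.+1 / k.+1%:R) + ((1 + r) ^+ 2 / 2 * F x
   + (1 - r) ^+ 2 / 2 * ((-1) ^+ k * F (- x)))) => [|x /andP[x0 xr]].
  by rewrite oppr0 F0 expr0n /= mul0r !mulr0 !addr0.
have dFN : r < 1 -> is_derive x 1 (fun y => (-1) ^+ k * F (- y))
    (- (x ^+ k / (1 - x))).
  move=> rlt1; have xN : -1 < - x by lra.
  have hN : is_derive x 1 (fun y : R => - y) (- 1) by exact: is_deriveNid.
  have h := is_derive_scale ((-1) ^+ k)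
    (@is_derive1_comp R F (fun y => - y) x _ _ (dF _ xN) hN).
  apply: (is_derive_eq h).
  have sign2 : (-1) ^+ k * (-1) ^+ k = 1 :> R.
    by rewrite -exprMn mulrNN mulr1 expr1n.
  rewrite -[RHS]mul1r -[X in _ = X * _]sign2 (exprNn x); ring.
have dlast : is_derive x 1 (fun y => (1 - r) ^+ 2 / 2 * ((-1) ^+ k * F (- y)))
    ((1 - r) ^+ 2 / 2 * (- (x ^+ k / (1 - x)))).
  have [rlt1|r1'] := ltP r 1; first exact/is_derive_scale/dFN.
  have -> : r = 1 by apply/eqP; rewrite eq_le r1 r1'.
  rewrite subrr expr0n /= !mul0r.
  rewrite (_ : (fun _ => _) = cst 0); first exact: is_derive_cst.
  by apply/funext => y; rewrite !mul0r.
have dx : -1 < x by lra.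
have h := is_derive_add
  (is_derive_scale (- r) (is_derive_monomial k x))
  (is_derive_add
     (is_derive_scale ((1 + r) ^+ 2 / 2) (dF x dx)) dlast).
apply: (is_derive_eq h); rewrite /weight.
(* At x = 1 the quotient w(x) / (1 - x^2) is 0 / 0, that is 0, which is also
   its limit. *)
have [xE|x1] := eqVneq x 1.
  have rE : r = 1 by lra.
  by rewrite xE rE !expr1n !subrr expr0n /= invr0 !mulr0 !mul0r; field.
have x1' : x < 1 by lra.
rewrite (_ : 1 - x ^+ 2 = (1 - x) * (1 + x)); last by ring.
field; apply/andP; split; lra.
Qed.

Definition weighted_monomial_primitive {R : realType} (r : R) (i : nat)
    (x : R) : R :=
  r * (x ^+ i.+1 / i.+1%:R) + (- (1 + r ^+ 2) * (x ^+ i.+2 / i.+2%:R)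
    + r * (x ^+ i.+3 / i.+3%:R)).

Lemma is_derive_weighted_monomial_primitive {R : realType} (r : R) i (x : R) :
  is_derive x 1 (weighted_monomial_primitive r i) (weight r x * x ^+ i).
Proof.
have h := is_derive_add
  (is_derive_scale r (is_derive_monomial i x))
 (is_derive_add
  (is_derive_scale (- (1 + r ^+ 2)) (is_derive_monomial i.+1 x))
  (is_derive_scale r (is_derive_monomial i.+2 x))).
apply: (is_derive_eq h); rewrite /weight !exprS; ring.
Qed.

Lemma weighted_monomial_primitive0 {R : realType} (r : R) i :
  weighted_monomial_primitive r i 0 = 0.
Proof. by rewrite /weighted_monomial_primitive !exprS !mul0r !mulr0 !addr0. Qed.

(** This is where the exact error integral is traded for a closed form.  The
    difference of the two sides is a sum of two squares, the second with the
    factor 1 + 2 r; at r = 1 it is (1 - x)^4, so nothing is lost to leading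
    order where the integrand concentrates when k is large. *)
Lemma weight_le {R : realType} (r x : R) : 0 < x < r -> r <= 1 ->
  2 * x * (1 + r) * weight r x <= r ^+ 2 * (1 - x ^+ 2) ^+ 2.
Proof.
move=> /andP[x0 xr] r1; rewrite -subr_ge0 /weight.
rewrite [leRHS](_ : _ = (r * (1 + x ^+ 2) - x * (1 + r)) ^+ 2
   + (x * (1 - r)) ^+ 2 * (1 + 2 * r)); last by ring.
have r0 : 0 <= 1 + 2 * r by lra.
by rewrite addr_ge0 ?sqr_ge0 // mulr_ge0 ?sqr_ge0.
Qed.

(** * The Blaschke factor and the truncated cosine expansion *)

(** |1 + r e^(it)|^2. *)
Definition sqmod {R : realType} (r t : R) : R := 1 + r ^+ 2 + 2 * r * cos t.

Lemma sqmodE {R : realType} (r t : R) :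
  sqmod r t = (cos t + r) ^+ 2 + sin t ^+ 2.
Proof. rewrite /sqmod sin2cos2; ring. Qed.

Lemma sqmod_ge0 {R : realType} (r t : R) : 0 <= sqmod r t.
Proof. by rewrite sqmodE addr_ge0 ?sqr_ge0. Qed.

Lemma sqmod_gt0 {R : realType} (r t : R) : 0 <= r < 1 -> 0 < sqmod r t.
Proof.
move=> /andP[r0 r1]; have c1 := cos_geN1 t; rewrite /sqmod.
have h : - r <= r * cos t by rewrite -mulrN1 ler_wpM2l.
have : 0 < (1 - r) ^+ 2 by rewrite exprn_gt0// subr_gt0.
lra.
Qed.

(** With z = e^(it), the left-hand side is the absolute value of
    Re (z^n (z + x)^2) and the right-hand side is |z + x|^2; their quotient is
    |Re (z^(n+1) (z + x) / (1 + x z))|. *)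
Lemma blaschke_le1 {R : realType} n (x t : R) :
  `|cos (t *+ n.+2) + 2 * x * cos (t *+ n.+1) + x ^+ 2 * cos (t *+ n)|
    <= sqmod x t.
Proof.
have X0 := sqmod_ge0 x t.
rewrite -[leRHS]ger0_norm // -ler_sqr ?nnegrE // !real_normK ?num_real//.
rewrite sqmodE mulrSr mulrSr !cosD !sinD.
have cs := cos2Dsin2 (t *+ n).
set p := cos (t *+ n) in cs *; set q := sin (t *+ n) in cs *.
set c := cos t; set s := sin t.
rewrite -subr_ge0.
(* The square of the modulus minus that of the real part is the square of the
   imaginary part; the second summand vanishes since p^2 + q^2 = 1. *)
rewrite [leRHS](_ : _ =
   (p * (2 * (c + x) * s) + q * ((c + x) ^+ 2 - s ^+ 2)) ^+ 2
   + (1 - (p ^+ 2 + q ^+ 2)) * ((c + x) ^+ 2 + s ^+ 2) ^+ 2); last by ring.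
by rewrite cs subrr mul0r addr0 sqr_ge0.
Qed.

(** The left-hand side is the derivative in [x] of X_r ln X_x plus a
    polynomial in cos t of degree at most n + 1.  Its middle term combines
    - 2 r (x + cos t) / x with the first harmonic: their poles at x = 0 cancel
    each other, which is why the sum starts at the second harmonic.  Each
    harmonic cancels the leading term of the remainder left by the previous
    ones, by the recurrence of the cosines. *)
Lemma kernel_sum {R : realType} (r x t : R) n : 0 < sqmod x t ->
  sqmod r t * (2 * (x + cos t) / sqmod x t)
    + (2 * cos t * (r * x - (1 + r ^+ 2)) - 2 * r)
    + 2 * \sum_(i < n) (-1) ^+ i.+1 * cos (t *+ i.+2) * (weight r x * x ^+ i)
  = 2 * (-1) ^+ n * weight r x * x ^+ n
      * (cos (t *+ n.+2) + x * cos (t *+ n.+1)) / sqmod x t.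
Proof.
move=> /lt0r_neq0; elim: n => [|n IHn] X0.
  rewrite big_ord0 cos_mulrSS mulr0n mulr1n cos0 !expr0.
  by move: X0; rewrite /weight /sqmod => X0; field.
rewrite big_ord_recr /= (mulrDr 2 (\sum_(i < n) _)) [LHS]addrA.
rewrite IHn // (cos_mulrSS t n.+1) !exprS.
move: X0; rewrite /weight /sqmod => X0; field => //.
Qed.

(** * Approximation on the unit-scaled interval *)

(** The logarithm is singular only if x = 1 and cos t = -1; then r = 1 and the
    factor X_r is 0, so the product is identically 0 and still derivable.
    This keeps the case a = 0 within reach of [dominated_increment]. *)
Lemma is_derive_scaled_ln {R : realType} (r x t : R) : 0 <= x <= r -> r <= 1 ->
  is_derive x 1 (fun y => sqmod r t * ln (sqmod y t))
    (sqmod r t * (2 * (x + cos t) / sqmod x t)).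
Proof.
move=> /andP[x0 xr] r1.
have [X0|X0] := ltP 0 (sqmod x t).
  apply: is_derive_scale.
  have h : is_derive x 1 (fun y : R => sqmod y t) (2 * (x + cos t)).
    pose g (y : R) := 1 + (2 * (y ^+ 2 / 2%:R) + 2 * cos t * (y ^+ 1 / 1%:R)).
    have hg := is_derive_add (f := cst 1) (x := x) (is_derive_cst _ _ _)
      (is_derive_add
        (is_derive_scale 2 (is_derive_monomial 1 x))
        (is_derive_scale (2 * cos t) (is_derive_monomial 0 x))).
    rewrite (_ : (fun y : R => sqmod y t) = g); last first.
      by apply/funext => y; rewrite /sqmod /g; field.
    by apply: (is_derive_eq hg); rewrite expr0 expr1; ring.
  have h2 := @is_derive1_comp R (@ln R) (fun y => sqmod y t) x _ _
    (is_derive1_ln X0) h.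
  by apply: (is_derive_eq h2); rewrite mulrC.
have x1 : x = 1.
  apply/eqP; rewrite eq_le (le_trans xr r1) leNgt /=; apply/negP => x1.
  by move: X0; rewrite leNgt sqmod_gt0 // x0.
have rx : r = x by apply/eqP; rewrite eq_le xr x1 r1.
have X00 : sqmod r t = 0 by apply/eqP; rewrite eq_le sqmod_ge0 rx X0.
rewrite X00 mul0r (_ : (fun _ => _) = cst 0); first exact: is_derive_cst.
by apply/funext => y; rewrite mul0r.
Qed.

(** The right-hand side is the integral of r^2 / (1 + r) (x^(k-2) - x^k) over
    [0, r]. *)
Lemma sqmod_ln_approx {R : realType} (r : R) k : 0 < r <= 1 -> (2 <= k)%N ->
  exists2 q : {poly R}, (size q <= k.+1)%N & forall t,
    `|sqmod r t * ln (sqmod r t) - q.[cos t]| <=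
    r ^+ 2 / (1 + r) * (r ^+ k.-1 / k.-1%:R - r ^+ k.+1 / k.+1%:R).
Proof.
case: k => [//|[//|K]] rI _ /=; have /andP[r0 r1] := rI.
have [B B0 dB] := antiderivative_singular_weight r K.+2 rI.
(* The degree is k = n + 1: S collects the harmonics 2, ..., k, lin those of
   order 0 and 1, and corr is the Blaschke correction of the k-th one. *)
pose n := K.+1.
pose S t x := 2 * \sum_(i < n) (-1) ^+ i.+1 * cos (t *+ i.+2)
  * weighted_monomial_primitive r i x.
pose lin t x := 2 * cos t * (r * (x ^+ 2 / 2%:R)
    + - (1 + r ^+ 2) * (x ^+ 1 / 1%:R)) + - 2 * r * (x ^+ 1 / 1%:R).
pose corr t x := 2 * (-1) ^+ n * cos (t *+ n.+1) * B x.
pose Q t x := lin t x + (S t x + corr t x).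
pose E t x := sqmod r t * ln (sqmod x t) + Q t x.
have [q sq hq] : cos_poly n.+1 (fun t => -1 * Q t r).
  apply: cos_polyZ; rewrite /Q; apply: cos_polyD; last apply: cos_polyD.
  - rewrite /lin.
    have cst_poly (c : R) : cos_poly n.+1 (fun=> c).
      exists c%:P => [|t]; last by rewrite hornerC.
      by rewrite (leq_trans (size_polyC_leq1 _)).
    apply: cos_polyD; last exact: cst_poly.
    set m := r * _ + _.
    have [p sp hp] := cos_polyZ n.+1 (2 * m) _
      (cos_poly_multiple n.+1 1 isT).
    by exists p => // t; rewrite -hp mulr1n; ring.
  - apply: cos_polyZ.
    apply: (cos_poly_sum n.+1 n
      (fun i t => (-1) ^+ i.+1 * cos (t *+ i.+2)
        * weighted_monomial_primitive r i r)) => i ni.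
    have [p sp hp] := cos_polyZ n.+1
      ((-1) ^+ i.+1 * weighted_monomial_primitive r i r) _
      (cos_poly_multiple n.+1 i.+2 ni).
    by exists p => // t; rewrite -hp; ring.
  - have [p sp hp] := cos_polyZ n.+1 (2 * (-1) ^+ n * B r) _
      (cos_poly_multiple n.+1 n.+1 (leqnn _)).
    by exists p => // t; rewrite -hp /corr; ring.
exists q => // t; rewrite -hq mulN1r opprK -/(E t r).
pose g x := r ^+ 2 / (1 + r) * (x ^+ n / n%:R + -1 * (x ^+ n.+2 / n.+2%:R)).
have E0 : E t 0 = 0.
  rewrite /E /Q /lin /S /corr B0 /sqmod.
  rewrite big1 ?expr1 ?expr2; last first.
    by move=> i _; rewrite weighted_monomial_primitive0 mulr0.
  by rewrite !(mul0r, mulr0, addr0) ln1 mulr0.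
have g0 : g 0 = 0 by rewrite /g /n !exprS !(mul0r, mulr0, addr0).
rewrite -[X in `|X|]subr0 -[X in _ - X]E0.
rewrite [leRHS](_ : _ = g r - g 0); last by rewrite g0 subr0 /g mulN1r.
pose dE x := (sqmod r t * (2 * (x + cos t) / sqmod x t)
  + ((2 * cos t * (r * x ^+ 1 + - (1 + r ^+ 2) * x ^+ 0) + - 2 * r * x ^+ 0)
   + (2 * \sum_(i < n) (-1) ^+ i.+1 * cos (t *+ i.+2) * (weight r x * x ^+ i)
   + 2 * (-1) ^+ n * cos (t *+ n.+1)
      * (weight r x * x ^+ n.+1 / (1 - x ^+ 2))))).
apply: (dominated_increment (E t) g dE
  (fun x => r ^+ 2 / (1 + r) * (x ^+ K + -1 * x ^+ n.+1)) r0) => x xI.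
- apply: is_derive_add; first exact: is_derive_scaled_ln.
  apply: is_derive_add; last apply: is_derive_add.
  + apply: is_derive_add; last exact/is_derive_scale/is_derive_monomial.
    by apply/is_derive_scale/is_derive_add;
      exact/is_derive_scale/is_derive_monomial.
  + apply: is_derive_scale.
    apply: (is_derive_bigsum n
      (fun i y => (-1) ^+ i.+1 * cos (t *+ i.+2)
        * weighted_monomial_primitive r i y)
      (fun i => (-1) ^+ i.+1 * cos (t *+ i.+2) * (weight r x * x ^+ i))) => i.
    exact/is_derive_scale/is_derive_weighted_monomial_primitive.
  + exact/is_derive_scale/dB.
- apply/is_derive_scale/is_derive_add; first exact: is_derive_monomial.
  exact/is_derive_scale/is_derive_monomial.
have /andP[x0 xr] := xI.
have x1 : x < 1 by exact: lt_le_trans xr r1.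
have X0 : 0 < sqmod x t by apply: sqmod_gt0; rewrite ltW.
have D0 : 0 < 1 - x ^+ 2 by rewrite subr_gt0 expr_lt1// ltW.
have w0 : 0 <= weight r x.
  rewrite /weight mulr_ge0// ?subr_ge0 ?(ltW xr)//.
  by rewrite (le_trans (ler_piMl (ltW x0) r1))// ltW.
have dEE : dE x = 2 * (-1) ^+ n * (weight r x * x ^+ n / (1 - x ^+ 2))
   * ((cos (t *+ n.+2) + 2 * x * cos (t *+ n.+1) + x ^+ 2 * cos (t *+ n))
       / sqmod x t).
  transitivity (2 * (-1) ^+ n * weight r x * x ^+ n
      * (cos (t *+ n.+2) + x * cos (t *+ n.+1)) / sqmod x t
      + 2 * (-1) ^+ n * cos (t *+ n.+1)
      * (weight r x * x ^+ n.+1 / (1 - x ^+ 2))).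
    rewrite -kernel_sum // /dE; ring.
  rewrite (cos_mulrSS t n) exprS.
  move: (lt0r_neq0 X0) (lt0r_neq0 D0); rewrite /sqmod => X0' D0'.
  by field; apply/andP.
rewrite dEE normrM.
have h1 : `|(cos (t *+ n.+2) + 2 * x * cos (t *+ n.+1) + x ^+ 2 * cos (t *+ n))
       / sqmod x t| <= 1.
  rewrite normrM normfV (gtr0_norm X0) ler_pdivrMr // mul1r.
  exact: blaschke_le1.
apply: (le_trans (ler_wpM2l (normr_ge0 _) h1)); rewrite mulr1.
have := weight_le r x xI r1; move: (weight r x) w0 => w w0 hw.
rewrite !normrM normrX normrN normr1 expr1n mulr1 normfV (gtr0_norm D0).
rewrite (ger0_norm w0) normrX (gtr0_norm x0) ger0_norm //.
rewrite mulrA ler_pdivrMr //.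
have r10 : 0 < 1 + r by lra.
rewrite [leRHS](_ : _ = r ^+ 2 * (x ^+ K + -1 * x ^+ n.+1) * (1 - x ^+ 2)
  / (1 + r)); last by ring.
rewrite ler_pdivlMr //.
have hx : 0 <= x ^+ K by rewrite exprn_ge0// ltW.
have := ler_wpM2l hx hw.
rewrite /n !exprS. lra.
Qed.

(** * The best approximation error of x ln x *)

Lemma best_approx_error_le {R : realType} (k : nat) (f : R -> R) (a b M : R)
    (p : {poly R}) : a <= b -> (size p <= k.+1)%N ->
  (forall x, a <= x <= b -> `|f x - p.[x]| <= M) ->
  best_approx_error k f a b <= M.
Proof.
move=> ab sp hM; have aI : `[a, b]%classic a by rewrite /= in_itv /= lexx.
apply: (@le_trans _ _ (uniform_error f a b p)).
  apply: ge_inf; last by exists p.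
  exists 0 => _ [q _ <-]; rewrite /uniform_error.
  set A := (X in sup X).
  have [hA|/sup_out->//] := pselect (has_sup A).
  apply: (le_trans (normr_ge0 (f a - q.[a]))).
  by apply: (ub_le_sup (proj2 hA)); exists a.
apply: ge_sup; first by exists `|f a - p.[a]|, a.
by move=> _ [x xI <-]; apply: hM; move: xI; rewrite /= in_itv.
Qed.

Lemma best_approx_xlnx_le {R : realType} (k : nat) (m r : R) :
  0 < m -> 0 < r <= 1 -> (2 <= k)%N ->
  best_approx_error k (fun x : R => x * ln x)
      (m * (1 - r) ^+ 2) (m * (1 + r) ^+ 2) <=
    m * (r ^+ 2 / (1 + r) * (r ^+ k.-1 / k.-1%:R - r ^+ k.+1 / k.+1%:R)).
Proof.
move=> m0 rI k2; have /andP[r0 r1] := rI.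
have [q sq hq] := sqmod_ln_approx r k rI k2.
pose l : {poly R} := (2 * m * r)^-1 *: 'X - ((1 + r ^+ 2) / (2 * r))%:P.
have sl : (size l <= 2)%N.
  rewrite (leq_trans (size_polyD _ _))// geq_max size_polyN.
  rewrite (leq_trans (size_scale_leq _ _)) ?size_polyX//.
  by rewrite (leq_trans (size_polyC_leq1 _)).
apply: (@best_approx_error_le R k _ _ _ _ (ln m *: 'X + m *: (q \Po l))).
- rewrite ler_pM2l// -subr_ge0 (_ : _ - _ = 4 * r); last by ring.
  by rewrite mulr_ge0// ltW.
- rewrite (leq_trans (size_polyD _ _))// geq_max; apply/andP; split.
    by rewrite (leq_trans (size_scale_leq _ _))// size_polyX ltnS ltnW.
  rewrite (leq_trans (size_scale_leq _ _))//.
  rewrite (leq_trans (size_comp_poly_leq _ _))// ltnS.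
  have h1 : ((size q).-1 <= k)%N by rewrite -subn1 leq_subLR add1n.
  have h2 : ((size l).-1 <= 1)%N by rewrite -subn1 leq_subLR.
  by rewrite -(muln1 k) leq_mul.
move=> x /andP[ax xb].
(* u is the affine image of x in [-1, 1], hence the cosine of some angle. *)
pose u := (2 * m * r)^-1 * x - (1 + r ^+ 2) / (2 * r).
have d0 : 0 < 2 * m * r by rewrite !mulr_gt0.
have uE : 2 * m * r * u = x - m * (1 + r ^+ 2).
  by rewrite /u; field; rewrite !lt0r_neq0.
have uI : -1 <= u <= 1.
  apply/andP; split; rewrite -(ler_pM2l d0) uE.
    rewrite (_ : _ * -1 = m * (1 - r) ^+ 2 - m * (1 + r ^+ 2)) ?lerB//; ring.
  rewrite (_ : _ * 1 = m * (1 + r) ^+ 2 - m * (1 + r ^+ 2)) ?lerB//; ring.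
have cu : cos (acos u) = u by apply: acosK; rewrite in_itv.
have xE : x = m * sqmod r (acos u).
  by rewrite /sqmod cu; move: uE; lra.
have lE : l.[x] = cos (acos u) by rewrite cu /l !hornerE.
rewrite !hornerD !hornerZ horner_comp hornerX lE.
have h : x * ln x - (ln m * x + m * q.[cos (acos u)])
   = m * (sqmod r (acos u) * ln (sqmod r (acos u)) - q.[cos (acos u)]).
  have [X0|X0] := ltP 0 (sqmod r (acos u)).
    by rewrite {1 2}xE lnM ?posrE// {1}xE; ring.
  have X00 : sqmod r (acos u) = 0.
    by apply/eqP; rewrite eq_le X0 sqmod_ge0.
  by rewrite xE X00; ring.
by rewrite h normrM (gtr0_norm m0) ler_pM2l.
Qed.

Theorem theorem2p2 (R : realType) (a b : R) (ha : 0 <= a) (hab : a < b)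
    (k : nat) (hk : (2 <= k)%N) :
  let gamma := a / b in
  best_approx_error k (fun x : R => x * ln x) a b <=
    b * (1 - Num.sqrt gamma)
      * ((1 + gamma + 2 * k%:R * Num.sqrt gamma) / (4 * (k%:R ^+ 2 - 1)))
      * ((1 - Num.sqrt gamma) / (1 + Num.sqrt gamma)) ^+ k.
Proof.
cbv zeta; set gamma := a / b.
have b0 : 0 < b by exact: le_lt_trans ha hab.
have g0 : 0 <= gamma by rewrite divr_ge0// ltW.
have g1 : gamma < 1 by rewrite ltr_pdivrMr// mul1r.
have gE : gamma = Num.sqrt gamma ^+ 2 by rewrite sqr_sqrtr.
set s := Num.sqrt gamma in gE *.
have s0 : 0 <= s := sqrtr_ge0 _.
have s1 : s < 1 by rewrite -(@expr_lt1 _ 2)// -gE.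
have sp : 0 < 1 + s by lra.
pose r := (1 - s) / (1 + s); pose m := b * (1 + s) ^+ 2 / 4.
have m0 : 0 < m by rewrite divr_gt0// mulr_gt0// exprn_gt0.
have rI : 0 < r <= 1.
  by rewrite divr_gt0 ?subr_gt0//= ler_pdivrMr// mul1r; lra.
have bE : b = m * (1 + r) ^+ 2 by rewrite /m /r; field; lra.
have aE : a = m * (1 - r) ^+ 2.
  have -> : a = b * s ^+ 2 by rewrite -gE mulrCA divff ?mulr1// lt0r_neq0.
  by rewrite /m /r; field; lra.
have := best_approx_xlnx_le k m r m0 rI hk.
rewrite -aE -bE => /le_trans; apply.
(* The two bounds are equal; with k = K + 2 this is a rational identity in s,
   once the common power r^K is abstracted. *)
rewrite le_eqVlt; apply/orP; left; apply/eqP.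
case: k hk => [//|[//|K]] _ /=.
rewrite gE -/r !exprS.
have K0 : 0 <= K%:R :> R by [].
move: (r ^+ K) => e; rewrite /m /r -!natr1.
by field; do ?[apply/andP; split]; nra.
Qed.
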